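(* Let $(X,\mathscr C,(\tau_K)_{K\in\mathscr C})$ be a compactological set. Then $\mathscr C\subseteq\mathcal P(X)$ has the following properties: (1) $\mathscr C$ contains the empty set. (2) $\mathscr C$ is a covering of $X$. (3) $\mathscr C$ is stable under finite unions. (4) $\mathscr C$ is stable under arbitrary intersections over non-empty index sets. (5) For any two points $x\neq y$ in $X$ and every $K\in\mathscr C$ containing both, there exist $K_1,K_2\in\mathscr C$ with $K=K_1\cup K_2$, $x\notin K_1$ and $y\notin K_2$. (6) Every collection $(K_i)_{i\in I}\subseteq\mathscr C$ with empty intersection admits a finite subcollection $(K_i)_{i\in I'}$ with empty intersection. Furthermore, if $X$ is a set and $\mathscr C\subseteq\mathcal P(X)$ satisfies (1)–(6), then there is a unique system of topologies $(\tau_K)_{K\in\mathscr C}$ such that $(X,\mathscr C,(\tau_K)_{K\in\mathscr C})$ is a compactological set. This system is given by $\tau_K:=\{K\setminus K'\mid K'\in\mathscr C\}$.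
   Context: ''Compact'' always means quasi-compact and Hausdorff. A compactological set is a triple $(X,\mathscr C,(\tau_K)_{K\in\mathscr C})$ where $X$ is a set, $\mathscr C\subseteq\mathcal P(X)$ is a non-empty collection of subsets, and each $\tau_K$ is a topology on $K$ such that $(K,\tau_K)$ is compact and: (a) $\bigcup_{K\in\mathscr C}K=X$; (b) for all $K_1,K_2\in\mathscr C$ there is $K_3\in\mathscr C$ with $K_1\subseteq K_3$ and $K_2\subseteq K_3$; (c) if $K_1,K_2\in\mathscr C$ and $K_2\subseteq K_1$ then $\tau_{K_2}=\tau_{K_1}|_{K_2}$; (d) if $K_1\in\mathscr C$ and $K_2\subseteq (K_1,\tau_{K_1})$ is compact then $K_2\in\mathscr C$. *)

(* Defs.v *)
From HB Require Import structures.
From mathcomp Require Import all_boot all_order.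
From mathcomp Require Import boolp classical_sets functions cardinality.
From mathcomp Require Import topology.

Set Implicit Arguments.
Unset Strict Implicit.
Unset Printing Implicit Defensive.

Local Open Scope classical_set_scope.

(* A topology on a subset K of X is given by its family op of open sets, which
   are themselves subsets of X contained in K.  The empty set is open as the
   union of the empty family. *)
Record topology_on (X : Type) (K : set X) (op : set (set X)) : Prop := {
  topology_on_sub : forall U, op U -> U `<=` K ;
  topology_on_full : op K ;
  topology_on_setI : forall U V, op U -> op V -> op (U `&` V) ;
  topology_on_bigcup : forall S : set (set X),
    S `<=` op -> op (\bigcup_(U in S) U) }.

(* The subset K, as a topologicalType whose open sets are given by op. *)
Definition top_space (X : Type) (K : set X) (op : set (set X))
  (opP : topology_on K op) : Type := set_type K.

Section TopSpace.
Context (X : Type) (K : set X) (op : set (set X)) (opP : topology_on K op).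

Let opens : set (set (top_space opP)) :=
  [set U : set (set_type K) | op (set_val @` U)].

Let opensT : opens setT.
Proof.
rewrite /opens /=; suff -> : set_val @` [set: set_type K] = K.
  exact: topology_on_full opP.
apply/seteqP; split=> [_ [x _ <-]|x Kx]; first exact: set_valP.
by exists (SigSub (mem_set Kx)).
Qed.

Let opensI : setI_closed opens.
Proof.
move=> U V oU oV; rewrite /opens /=.
suff -> : set_val @` (U `&` V) = (set_val @` U) `&` (set_val @` V).
  exact: topology_on_setI opP _ _ oU oV.
apply/seteqP; split=> [_ [x [Ux Vx] <-]|_ [[x Ux <-] [y Vy]]].
  by split; exists x.
by move=> /val_inj yx; exists x => //; split=> //; rewrite -yx.
Qed.

Let opens_bigU (I : Type) (f : I -> set (top_space opP)) :
  (forall i, opens (f i)) -> opens (\bigcup_i f i).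
Proof.
move=> of_; rewrite /opens /=.
suff -> : set_val @` (\bigcup_i f i) =
    \bigcup_(U in [set (set_val @` f i : set X) | i in [set: I]]) U.
  by apply: (topology_on_bigcup opP) => _ [i _ <-]; exact: of_.
apply/seteqP; split=> [_ [x [i _ fix_] <-]|x [_ [i _ <-] [y fiy <-]]].
  by exists (set_val @` f i); [exists i|exists x].
by exists y => //; exists i.
Qed.

HB.instance Definition _ := gen_eqMixin (top_space opP).
HB.instance Definition _ := gen_choiceMixin (top_space opP).
HB.instance Definition _ :=
  isOpenTopological.Build (top_space opP) opensT opensI opens_bigU.

Lemma top_space_openE (U : set (top_space opP)) :
  open U = op (set_val @` (U : set (set_type K))).
Proof. by []. Qed.

End TopSpace.

(* op is a topology on K for which K is quasi-compact and Hausdorff. *)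
Definition compact_space_on (X : Type) (K : set X) (op : set (set X)) : Prop :=
  exists opP : topology_on K op,
    compact [set: top_space opP] /\ hausdorff_space (top_space opP).

Definition restrict_topology (X : Type) (op : set (set X)) (K : set X) :
  set (set X) := [set U `&` K | U in op].

Record compactological (X : Type) (C : set (set X))
    (tau : set_type C -> set (set X)) : Prop := {
  compactological_neq0 : C !=set0 ;
  compactological_compact : forall K : set_type C,
    compact_space_on (val K) (tau K) ;
  compactological_cover : \bigcup_(K in C) K = setT ;
  compactological_directed : forall K1 K2, C K1 -> C K2 ->
    exists K3, [/\ C K3, K1 `<=` K3 & K2 `<=` K3] ;
  compactological_restrict : forall K1 K2 : set_type C,
    val K2 `<=` val K1 -> tau K2 = restrict_topology (tau K1) (val K2) ;
  compactological_subset : forall (K1 : set_type C) (K2 : set X),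
    K2 `<=` val K1 ->
    compact_space_on K2 (restrict_topology (tau K1) K2) -> C K2 }.

(* An intersection over the empty index set is all of X, which matters in
   compact_collection_finite. *)
Record compact_collection (X : Type) (C : set (set X)) : Prop := {
  compact_collection0 : C set0 ;
  compact_collection_cover : \bigcup_(K in C) K = setT ;
  compact_collection_bigcup : forall (I : Type) (D : set I) (K : I -> set X),
    finite_set D -> (forall i, D i -> C (K i)) -> C (\bigcup_(i in D) K i) ;
  compact_collection_bigcap : forall (I : Type) (D : set I) (K : I -> set X),
    D !=set0 -> (forall i, D i -> C (K i)) -> C (\bigcap_(i in D) K i) ;
  compact_collection_split : forall (x y : X) (K : set X), x <> y ->
    C K -> K x -> K y ->
    exists K1 K2, [/\ C K1, C K2, K = K1 `|` K2, ~ K1 x & ~ K2 y] ;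
  compact_collection_finite : forall (I : Type) (D : set I) (K : I -> set X),
    (forall i, D i -> C (K i)) -> \bigcap_(i in D) K i = set0 ->
    exists D' : set I,
      [/\ D' `<=` D, finite_set D' & \bigcap_(i in D') K i = set0] }.

(* Main.v *)
(* Everything rests on one fact: if K is in C, then a subset F of K is in C iff
   F is closed in K.  Closed subsets of K are compact, hence in C by (d);
   conversely a member F of C carries the subspace topology by (c), so it is a
   compact subset of a Hausdorff space.  Thus (1)-(6) are statements about closed
   sets, and the open sets of K must be the complements in K of members of C.
   For the converse, (1), (3), (4) make the sets K \ K' a topology, (5) is its
   Hausdorff property and (6) its quasi-compactness. *)

Require Import Defs.
From HB Require Import structures.
From mathcomp Require Import all_boot all_order finmap.
From mathcomp Require Import boolp classical_sets functions cardinality.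
From mathcomp Require Import topology.

Local Open Scope classical_set_scope.

(** * Finite sets, complements, and compactness by open covers *)

Lemma finite_set_ind {T : Type} (P : set T -> Prop) :
  P set0 -> (forall x A, P A -> P (x |` A)) ->
  forall A, finite_set A -> P A.
Proof.
(* The bare type [T] receives a classical choice structure, so that its finite sets can be listed as
   sequences. *)
elim/Pchoice: T => T in P *.
move=> P0 PU _ /finite_seqP[s ->]; elim: s => [|x s IH].
  by rewrite set_nil.
suff -> : [set` x :: s] = x |` [set` s] by exact: PU.
by apply/seteqP; split=> y /=; rewrite inE => /predU1P.
Qed.

(** Turns a finite subcover, obtained as a set of sets, back into a finite set of indices. *)
Lemma finite_sub_image {I T : Type} (D : set I) (f : I -> T) (S : set T) :
  finite_set S -> S `<=` f @` D ->
  exists D', [/\ D' `<=` D, finite_set D' & S = f @` D'].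
Proof.
move: S; apply: finite_set_ind => [_|x A IH xAD].
  by exists set0; split => //; rewrite image_set0.
have [D' [D'D finD' AE]] : exists D', [/\ D' `<=` D, finite_set D' & A = f @` D'].
  by apply: IH => y Ay; apply: xAD; right.
have [i Di fix_] : (f @` D) x by apply: xAD; left.
exists (i |` D'); split.
- by move=> ? [->|/D'D].
- by rewrite finite_setU.
- by rewrite image_setU image_set1 fix_ -AE.
Qed.

Lemma setD_bigcap {I T : Type} (A : set T) (D : set I) (F : I -> set T) :
  A `\` \bigcap_(i in D) F i = \bigcup_(i in D) (A `\` F i).
Proof. by rewrite setDE setC_bigcap setI_bigcupr. Qed.

(* [compact_cover] holds without a distinguished point: an empty space is
   trivially compact in both senses. *)
Lemma compact_coverP (T : topologicalType) (A : set T) :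
  compact A <-> cover_compact A.
Proof.
have [[x _]|T0] := pselect (exists x : T, True).
  pose pT := HB.pack_for ptopologicalType T (isPointed.Build T x).
  have cE : @compact T = @cover_compact T := @compact_cover pT.
  by rewrite cE.
have -> : A = set0 by apply/seteqP; split => x; case: T0; exists x.
split=> [_ I D f _ _|_]; last exact: compact0.
by exists fset0.
Qed.

(** * Compactness and the Hausdorff property without subtypes *)

(** Quasi-compactness phrased with subsets of [X] only, so that different [K] can be compared
    without passing through [top_space]. *)
Definition finite_subcovers {X : Type} (K : set X) (op : set (set X)) : Prop :=
  forall S : set (set X), S `<=` op -> K `<=` \bigcup_(U in S) U ->
  exists S', [/\ S' `<=` S, finite_set S' & K `<=` \bigcup_(U in S') U].

Definition separates_points {X : Type} (K : set X) (op : set (set X)) : Prop :=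
  forall x y, K x -> K y -> x <> y ->
  exists U V, [/\ op U, op V, U x, V y & U `&` V = set0].

Section TopSpaceSets.
Context {X : Type} (K : set X) (op : set (set X)) (opP : topology_on K op).

Let val_preimage {U} : U `<=` K ->
  set_val @` [set t : set_type K | U (val t)] = U.
Proof.
move=> UK; apply/seteqP; split=> [_ [t Ut <-] //|x Ux].
by exists (SigSub (mem_set (UK _ Ux))).
Qed.

Lemma top_space_compactP :
  compact [set: top_space opP] <-> finite_subcovers K op.
Proof.
split=> [/compact_coverP cK S Sop KS|fK].
  (* The cover is indexed by its own members; [{classic set X}] supplies the choice structure
     required of an index type. *)
  pose f (U : {classic set X}) : set (top_space opP) :=
    [set t : set_type K | U (val t)].
  have [|t _|D' D'S cov] := cK {classic set X} S f.
  - move=> U SU; rewrite top_space_openE val_preimage; first exact: Sop.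
    by apply: (topology_on_sub opP); exact: Sop.
  - have /KS[U SU Ut] : K (val (t : set_type K)) by exact: set_valP.
    by exists U.
  - exists [set` D']; split.
    + by move=> U /D'S /set_mem.
    + exact: finite_fset.
    + by move=> x Kx; have [//|U ? ?] := cov (SigSub (mem_set Kx)); exists U.
apply/compact_coverP => I D f fop cov.
have [||S [SD finS KS]] := fK [set set_val @` (f i : set (set_type K)) | i in D].
- by move=> _ [i Di <-]; rewrite -top_space_openE; exact: fop.
- move=> x Kx; have [//|i Di fix_] := cov (SigSub (mem_set Kx)).
  exists (set_val @` (f i : set (set_type K))); first by exists i.
  by exists (SigSub (mem_set Kx)).
have [D' [D'D finD' SE]] := finite_sub_image _ _ _ finS SD.
exists (fset_set D').
  by move=> i; rewrite in_fset_set // => /set_mem /D'D /mem_set.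
move=> t _; have /KS : K (val (t : set_type K)) by exact: set_valP.
rewrite SE bigcup_image => -[i D'i [u fiu /val_inj <-]].
by exists i => //=; rewrite in_fset_set // mem_set.
Qed.

Lemma top_space_hausdorffP :
  hausdorff_space (top_space opP) <-> separates_points K op.
Proof.
rewrite open_hausdorff; split=> [hK x y Kx Ky xy|sK s t st].
  pose s : top_space opP := SigSub (mem_set Kx).
  pose t : top_space opP := SigSub (mem_set Ky).
  have [|[A B] /= [/set_mem As /set_mem Bt] [oA oB /eqP AB0]] := hK s t.
    by apply/eqP => /(congr1 (set_val : set_type K -> X)).
  exists (set_val @` (A : set (set_type K))), (set_val @` (B : set (set_type K))).
  split; rewrite -?top_space_openE //; [by exists s|by exists t|].
  apply/seteqP; split=> // _ [[u Au <-] [v Bv /val_inj vu]].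
  by have : (A `&` B) u; [split=> //; rewrite -vu|rewrite AB0].
have [|||U [V [oU oV Us Vt UV0]]] :=
  sK (val (s : set_type K)) (val (t : set_type K)); try exact: set_valP.
  by move/val_inj => E; move/eqP: st; apply.
exists ([set t : set_type K | U (val t)], [set t : set_type K | V (val t)]).
  by split; exact: mem_set.
split; rewrite ?top_space_openE ?val_preimage //; try exact: (topology_on_sub opP).
apply/eqP/seteqP; split=> // u [/= Uu Vu].
by have : (U `&` V) (val u) by []; rewrite UV0.
Qed.

End TopSpaceSets.

Lemma compact_space_onP {X : Type} (K : set X) (op : set (set X)) :
  compact_space_on K op <->
  [/\ topology_on K op, finite_subcovers K op & separates_points K op].
Proof.
split=> [[opP [/top_space_compactP ? /top_space_hausdorffP ?]] //|[opP ? ?]].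
by exists opP; split; [apply/top_space_compactP|apply/top_space_hausdorffP].
Qed.

(** * Subspaces: closed subsets versus compact subsets *)

Lemma topology_on_set0 {X : Type} {K : set X} {op : set (set X)} :
  topology_on K op -> op set0.
Proof.
by move=> opP; rewrite -(bigcup_set0 id); exact: (topology_on_bigcup opP).
Qed.

Lemma topology_on_setU {X : Type} {K : set X} {op : set (set X)} U V :
  topology_on K op -> op U -> op V -> op (U `|` V).
Proof.
move=> opP oU oV; have -> : U `|` V = \bigcup_(W in [set U; V]) W.
  by rewrite bigcup_setU !bigcup_set1.
by apply: (topology_on_bigcup opP) => _ [] ->.
Qed.

Lemma restrict_topology_on {X : Type} {K F : set X} {op : set (set X)} :
  F `<=` K -> topology_on K op -> topology_on F (restrict_topology op F).
Proof.
move=> FK opP; split.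
- by move=> _ [U _ <-] x [].
- by exists K; [exact: topology_on_full opP|exact/setIidPr].
- move=> _ _ [U oU <-] [V oV <-]; exists (U `&` V); last by rewrite setIIl.
  exact: topology_on_setI opP _ _ oU oV.
(* Taking every open [U] whose trace lies in [S] avoids choosing one for each member of [S]. *)
- move=> S Sop; exists (\bigcup_(U in [set U | op U /\ S (U `&` F)]) U).
    by apply: (topology_on_bigcup opP) => U [].
  apply/seteqP; split=> [x [[U [oU SU] Ux] Fx]|x [W SW Wx]].
    by exists (U `&` F).
  have [U oU UW] := Sop _ SW; rewrite -UW in SW Wx.
  by case: Wx => Ux Fx; split=> //; exists U.
Qed.

Lemma closed_compact_space_on {X : Type} {K F : set X} {op : set (set X)} :
  compact_space_on K op -> F `<=` K -> op (K `\` F) ->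
  compact_space_on F (restrict_topology op F).
Proof.
move=> /compact_space_onP[opP fK sK] FK oKF; apply/compact_space_onP; split.
- exact: restrict_topology_on FK opP.
- move=> S Sop FS.
  (* A cover of [F] is lifted to [K] and completed by the open complement of [F], which is dropped
     again from the finite subcover. *)
  pose S1 := (K `\` F) |` [set U | op U /\ S (U `&` F)].
  have [||S' [S'S1 finS' KS']] := fK S1.
  + by move=> U [->|[]].
  + move=> x Kx; have [Fx|nFx] := pselect (F x); last first.
      by exists (K `\` F); [left|split].
    have [W SW Wx] := FS x Fx; have [U oU UW] := Sop _ SW.
    rewrite -UW in SW Wx; case: Wx => Ux _.
    by exists U => //; right.
  exists [set U `&` F | U in S' `\ (K `\` F)]; split.
  + by move=> _ [U [/S'S1[UE|[_ SU]] nU] <-]; [case: nU|].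
  + by apply: finite_image; exact: finite_setD.
  + move=> x Fx; have [U S'U Ux] := KS' x (FK x Fx).
    exists (U `&` F) => //; exists U => //; split=> //= E.
    by move: Ux; rewrite E => -[].
- move=> x y Fx Fy /(sK _ _ (FK _ Fx) (FK _ Fy))[U [V [oU oV Ux Vy UV0]]].
  exists (U `&` F), (V `&` F); split=> //; [by exists U|by exists V|].
  by rewrite -setIIl UV0 set0I.
Qed.

Lemma compact_space_on_closed {X : Type} {K F : set X} {op : set (set X)} :
  compact_space_on K op -> F `<=` K ->
  compact_space_on F (restrict_topology op F) -> op (K `\` F).
Proof.
move=> /compact_space_onP[opP _ sK] FK /compact_space_onP[_ fF _].
suff -> : K `\` F = \bigcup_(V in [set V | op V /\ V `<=` K `\` F]) V.
  by apply: (topology_on_bigcup opP) => V [].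
apply/seteqP; split=> [y [Ky nFy]|y [V [_ VKF] Vy]]; last exact: VKF.
(* By the Hausdorff property, the traces on [F] that miss some neighbourhood of [y] cover [F]. *)
pose apart (W : set X) := exists V, [/\ op V, V y & W `&` V = set0].
have [||S' [S'S finS' FS']] :=
  fF [set W | restrict_topology op F W /\ apart W].
- by move=> W [].
- move=> x Fx.
  have [|U [V [oU oV Ux Vy UV0]]] := sK x y (FK _ Fx) Ky.
    by move=> E; apply: nFy; rewrite -E.
  exists (U `&` F) => //; split; first by exists U.
  by exists V; split=> //; rewrite setIAC UV0 set0I.
(* Intersecting the finitely many neighbourhoods of [y] gives one that misses all of [F]. *)
have : apart (\bigcup_(W in S') W).
  have S'a : S' `<=` apart by move=> W /S'S[].
  move: S' finS' S'a {S'S FS'}; apply: finite_set_ind => [_|W A IH WA].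
    exists K; split=> //; first exact: topology_on_full opP.
    by rewrite bigcup_set0 set0I.
  have [U [oU Uy WU0]] : apart W by apply: WA; left.
  have [V [oV Vy AV0]] : apart (\bigcup_(W in A) W).
    by apply: IH => B AB; apply: WA; right.
  exists (U `&` V); split=> //; first exact: topology_on_setI opP _ _ oU oV.
    by rewrite bigcup_setU1 setIUl setIA WU0 set0I set0U setIC -setIA (setIC V) AV0 setI0.
move=> [V [oV Vy FV0]]; exists V => //; split=> // x Vx; split.
  exact: topology_on_sub opP _ oV _ Vx.
by move=> /FS' FS'x; have : (\bigcup_(W in S') W `&` V) x by []; rewrite FV0.
Qed.

(** * From a compactological set to (1)-(6), and the form of its topologies *)

Section CompactologicalClosed.
Context {X : Type} {C : set (set X)} {tau : set_type C -> set (set X)}.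
Hypothesis tauP : compactological tau.

Lemma compactological_topology (K : set_type C) : topology_on (val K) (tau K).
Proof. by have /compact_space_onP[] := compactological_compact tauP K. Qed.

Lemma compactological_closed (K : set_type C) (F : set X) :
  F `<=` val K -> tau K (val K `\` F) <-> C F.
Proof.
move=> FK; split=> [oKF|CF].
  apply: (compactological_subset tauP FK).
  exact: closed_compact_space_on (compactological_compact tauP K) FK oKF.
apply: (compact_space_on_closed (compactological_compact tauP K) FK).
pose L : set_type C := SigSub (mem_set CF).
rewrite -(compactological_restrict tauP (K1 := K) (K2 := L) FK).
exact: (compactological_compact tauP L).
Qed.

Lemma compactological_set0 : C set0.
Proof.
have [K CK] := compactological_neq0 tauP.
apply/(@compactological_closed (SigSub (mem_set CK))) => //.
by rewrite setD0; exact: topology_on_full (compactological_topology _).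
Qed.

(** Directedness places both sets in one member of [C], where they are closed. *)
Lemma compactological_setU A B : C A -> C B -> C (A `|` B).
Proof.
move=> CA CB; have [K [CK AK BK]] := compactological_directed tauP CA CB.
pose L : set_type C := SigSub (mem_set CK).
apply/(compactological_closed L); first by rewrite subUset.
rewrite setDUr; apply: (topology_on_setI (compactological_topology L)).
  exact/(compactological_closed L).
exact/(compactological_closed L).
Qed.

Lemma compactological_setI A B : C A -> C B -> C (A `&` B).
Proof.
move=> CA CB; have [K [CK AK BK]] := compactological_directed tauP CA CB.
pose L : set_type C := SigSub (mem_set CK).
apply/(compactological_closed L); first by move=> x [/AK].
rewrite setDIr; apply: (topology_on_setU _ _ (compactological_topology L)).
  exact/(compactological_closed L).
exact/(compactological_closed L).
Qed.

(** Since [C] alone determines [tau], this also gives uniqueness. *)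
Lemma compactological_openE (K : set_type C) :
  tau K = [set val K `\` K' | K' in C].
Proof.
apply/seteqP; split=> [U oU|_ [A CA <-]].
  have UK : U `<=` val K by exact: topology_on_sub (compactological_topology K) _ oU.
  have UE : val K `\` (val K `\` U) = U by rewrite setDD; exact/setIidPr.
  exists (val K `\` U) => //; apply/(compactological_closed K); first by move=> x [].
  by rewrite UE.
(* [A] need not lie in [K], so it is replaced by its trace on [K]. *)
have -> : val K `\` A = val K `\` (val K `&` A) by rewrite setDIr setDv set0U.
apply/compactological_closed; first by move=> x [].
by apply: compactological_setI => //; exact: set_valP.
Qed.

Lemma compactological_collection : compact_collection C.
Proof.
split.
- exact: compactological_set0.
- exact: compactological_cover tauP.
- move=> I D K; move: D; apply: finite_set_ind => [_|i D IH CK].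
    by rewrite bigcup_set0; exact: compactological_set0.
  rewrite bigcup_setU1; apply: compactological_setU; first by apply: CK; left.
  by apply: IH => j Dj; apply: CK; right.
- move=> I D K [i Di] CK; pose L : set_type C := SigSub (mem_set (CK i Di)).
  apply/(compactological_closed L); first by move=> x /(_ i Di).
  rewrite setD_bigcap.
  have -> : \bigcup_(j in D) (K i `\` K j) =
      \bigcup_(U in [set K i `\` K j | j in D]) U by rewrite bigcup_image.
  apply: (topology_on_bigcup (compactological_topology L)) => _ [j Dj <-].
  by rewrite (compactological_openE L); exists (K j) => //; exact: (CK j Dj).
- move=> x y K xy CK Kx Ky; pose L : set_type C := SigSub (mem_set CK).
  have /compact_space_onP[opP _ sK] := compactological_compact tauP L.
  have [U [V []]] := sK x y Kx Ky xy.
  rewrite !(compactological_openE L) => -[A CA <-] [B CB <-] [_ nAx] [_ nBy] AB0.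
  (* The closed complements of two disjoint open sets cover [K]. *)
  exists (K `&` A), (K `&` B); split; try exact: compactological_setI.
  + rewrite -setIUr; apply/esym/setIidPl => z Kz; apply: contrapT => nABz.
    suff : ((K `\` A) `&` (K `\` B)) z by rewrite AB0.
    by split; split=> // ?; apply: nABz; [left|right].
  + by case.
  + by case.
- move=> I D K CK DK0.
  (* An empty [D] is already finite; otherwise some [K i] serves as the ambient compact space. *)
  have [[i Di]|nD] := pselect (D !=set0); last first.
    by exists D; split=> //; rewrite (_ : D = set0) //; exact/nonemptyPn.
  pose L : set_type C := SigSub (mem_set (CK i Di)).
  have /compact_space_onP[opP fK _] := compactological_compact tauP L.
  have [||S [SD finS KS]] := fK [set K i `\` K j | j in D].
  + by move=> _ [j Dj <-]; rewrite (compactological_openE L); exists (K j) => //; exact: (CK j Dj).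
  + by rewrite bigcup_image -setD_bigcap DK0 setD0.
  have [D' [D'D finD' SE]] := finite_sub_image _ _ _ finS SD.
  (* The complements were taken inside [K i], so the index [i] must be kept to confine the
     intersection to [K i]. *)
  exists (i |` D'); split.
  + by move=> ? [->|/D'D].
  + by rewrite finite_setU.
  + apply/seteqP; split=> // x Kx.
    have /KS : K i x by apply: Kx; left.
    by rewrite SE bigcup_image => -[j D'j [_]]; apply; apply: Kx; right.
Qed.

End CompactologicalClosed.

(** * From (1)-(6) to a compactological set *)

Section CollectionTopology.
Context {X : Type} {C : set (set X)}.
Hypothesis CP : compact_collection C.

Let tau (K : set_type C) : set (set X) := [set val K `\` K' | K' in C].

Lemma compact_collection_setU A B : C A -> C B -> C (A `|` B).
Proof.
move=> CA CB; have -> : A `|` B = \bigcup_(W in [set A; B]) W.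
  by rewrite bigcup_setU !bigcup_set1.
by apply: (compact_collection_bigcup CP) => // _ [] ->.
Qed.

Lemma compact_collection_setI A B : C A -> C B -> C (A `&` B).
Proof.
move=> CA CB; have -> : A `&` B = \bigcap_(W in [set A; B]) W.
  by rewrite bigcap_setU !bigcap_set1.
by apply: (compact_collection_bigcap CP); [exists A; left|move=> _ [] ->].
Qed.

Lemma collection_topology_on (K : set_type C) : topology_on (val K) (tau K).
Proof.
split.
- by move=> _ [A _ <-] x [].
- by exists set0; [exact: compact_collection0 CP|rewrite setD0].
- move=> _ _ [A CA <-] [B CB <-]; exists (A `|` B); last by rewrite setDUr.
  exact: compact_collection_setU.
(* [val K] is added so that the intersection is never empty-indexed. *)
- move=> S Stau; pose D := val K |` [set A | C A /\ S (val K `\` A)].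
  exists (\bigcap_(A in D) A).
    apply: (compact_collection_bigcap CP); first by exists (val K); left.
    by move=> ? [->|[]//]; exact: set_valP.
  rewrite setD_bigcap /D bigcup_setU1 setDv set0U.
  apply/seteqP; split=> [x [A [_ SA] Ax]|x [U SU Ux]]; first by exists (val K `\` A).
  have [A CA AU] := Stau _ SU; rewrite -AU in SU Ux.
  by exists A.
Qed.

Lemma collection_finite_subcovers (K : set_type C) :
  finite_subcovers (val K) (tau K).
Proof.
(* Complements turn a cover of [K] into a family with empty intersection in [K]; adjoining [K] makes
   the intersection empty in [X], as (6) requires. *)
move=> S Stau KS; pose D := val K |` [set A | C A /\ S (val K `\` A)].
have [||D' [D'D finD' D'0]] := compact_collection_finite CP (D := D) (K := id).
- by move=> ? [->|[]//]; exact: set_valP.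
- apply/seteqP; split=> // x Dx.
  have Kx : val K x by apply: Dx; left.
  have [U SU Ux] := KS x Kx; have [A CA AU] := Stau _ SU.
  rewrite -AU in SU Ux; case: Ux => _; apply.
  by apply: Dx; right.
(* [K] is removed because its complement in [K], the empty set, need not belong to [S] and covers
   nothing. *)
exists [set val K `\` A | A in D' `\ val K]; split.
- by move=> _ [A [/D'D[AE|[_ SA]] nA] <-]; [case: nA|].
- by apply: finite_image; exact: finite_setD.
- move=> x Kx; rewrite bigcup_image; apply: contrapT => nx.
  suff : (\bigcap_(A in D') A) x by rewrite D'0.
  move=> A D'A; apply: contrapT => nAx; apply: nx; exists A => //.
  by split=> //= E; apply: nAx; rewrite E.
Qed.

(** The two sets given by (5) cover [K], so their complements in [K] are disjoint. *)
Lemma collection_separates_points (K : set_type C) :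
  separates_points (val K) (tau K).
Proof.
move=> x y Kx Ky xy.
have [A [B [CA CB KE nAx nBy]]] :=
  compact_collection_split CP xy (set_valP K) Kx Ky.
exists (val K `\` A), (val K `\` B); split=> //; [by exists A|by exists B|].
by rewrite -setDUr {1}KE setDv.
Qed.

Lemma collection_compactological : compactological tau.
Proof.
have tauP K : compact_space_on (val K) (tau K).
  apply/compact_space_onP; split.
  - exact: collection_topology_on.
  - exact: collection_finite_subcovers.
  - exact: collection_separates_points.
split=> //.
- by exists set0; exact: compact_collection0 CP.
- exact: compact_collection_cover CP.
- move=> A B CA CB; exists (A `|` B); split; first exact: compact_collection_setU.
    by move=> x; left.
  by move=> x; right.
- move=> K L LK.
  (* The same [A] describes an open set of [K] and its trace on [L], whence (c). *)
  have LE A : (val K `\` A) `&` val L = val L `\` A.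
    by rewrite setIDAC setIDA; congr (_ `\` _); exact/setIidPr.
  apply/seteqP; split=> [_ [A CA <-]|_ [_ [A CA <-] <-]].
    by exists (val K `\` A); [exists A|].
  by rewrite LE; exists A.
(* For (d), a compact [F] is closed in the Hausdorff space [K], so it is the trace on [K] of a
   member of [C]. *)
- move=> K F FK cF; have [A CA KAF] := compact_space_on_closed (tauP K) FK cF.
  have -> : F = val K `&` A by rewrite -setDD KAF setDD; exact/esym/setIidPr.
  by apply: compact_collection_setI => //; exact: set_valP.
Qed.

End CollectionTopology.

Theorem proposition2p12 (X : Type) (C : set (set X)) :
  (forall tau : set_type C -> set (set X),
     compactological tau -> compact_collection C) /\
  (compact_collection C ->
     (exists! tau : set_type C -> set (set X), compactological tau) /\
     (forall tau : set_type C -> set (set X), compactological tau ->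
        forall K : set_type C, tau K = [set val K `\` K' | K' in C])).
Proof.
split=> [tau tauP|CP]; first exact: compactological_collection tauP.
split=> [|tau tauP K]; last exact: compactological_openE.
exists (fun K => [set val K `\` K' | K' in C]); split.
  exact: collection_compactological.
by move=> tau tauP; apply/funext => K; rewrite (compactological_openE tauP).
Qed.
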